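(* Let $\mathcal{O}$ be a Dedekind domain. Let $\mathcal{L}\supseteq \mathcal{K}$ be two nonzero ideals of $\mathcal{O}$ with $\mathcal{K}\subsetneq \mathcal{O}$, let $\mathcal{I}$ be the ideal given by the factorization $\mathcal{K}=\mathcal{L}\mathcal{I}$, and let $[a:b]\in \mathbb{PF}^1_{\mathcal{I}}$. Then there exists a co-torsion $\mathcal{O}$-submodule $M\subsetneq \mathcal{O}^2$ whose invariant factor ideals are $\mathcal{L}\supseteq \mathcal{K}$ and whose projective space invariant element is $[a:b]\in \mathbb{PF}^1_{\mathcal{I}}$.
   Context: An $\mathcal{O}$-submodule $M\subseteq \mathcal{O}^2$ is co-torsion if $\mathcal{O}^2/M$ is a torsion $\mathcal{O}$-module. Projective space: let $(\mathcal{O}^2)^{*}=\{(a,b)\in \mathcal{O}^2\mid \langle a\rangle +\langle b\rangle = \mathcal{O}\}$. For an ideal $\mathcal{I}\subseteq\mathcal{O}$, define the equivalence relation on $(\mathcal{O}^2)^*$ by $(a,b)\sim (c,d)$ iff $ad-bc\in \mathcal{I}$. Then $\mathbb{PF}^1_{\mathcal{I}}=(\mathcal{O}^2)^{*}/\sim$, and the class of $(a,b)$ is denoted $[a:b]$. Invariants of a co-torsion submodule $M\subsetneq\mathcal{O}^2$: there are finitely many distinct maximal ideals $\mathcal{M}_1,\dots,\mathcal{M}_r$ of $\mathcal{O}$ (the elementary maximal ideal divisors) and integers $0\le l_i\le k_i\ne 0$, $1\le i\le r$, with $\mathcal{O}^2/M\cong\bigoplus_{i=1}^r\big(\mathcal{O}/\mathcal{M}_i^{l_i}\oplus\mathcal{O}/\mathcal{M}_i^{k_i}\big)$.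 The invariant factor ideals are $\mathcal{L}=\prod_{i=1}^r\mathcal{M}_i^{l_i}\supseteq\mathcal{K}=\prod_{i=1}^r\mathcal{M}_i^{k_i}$, so that $\mathcal{O}^2/M\cong\mathcal{O}/\mathcal{L}\oplus\mathcal{O}/\mathcal{K}$. The projective space invariant ideal is $\mathcal{I}=\prod_{i=1}^r\mathcal{M}_i^{k_i-l_i}$, so $\mathcal{K}=\mathcal{L}\mathcal{I}$. The projective space invariant element of $M$ is the class $[a:b]\in\mathbb{PF}^1_{\mathcal{I}}$ of any $(a,b)\in(\mathcal{O}^2)^*$ for which there is $t\in\mathcal{L}\setminus\bigcup_{i=1}^r\mathcal{L}\mathcal{M}_i$ with $(ta,tb)\in M$; such a pair exists and its class in $\mathbb{PF}^1_{\mathcal{I}}$ depends only on $M$. *)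

(* Defs.v *)
From HB Require Import structures.
From mathcomp Require Import all_boot all_algebra.
From mathcomp Require Import boolp classical_sets.

Set Implicit Arguments.
Unset Strict Implicit.
Unset Printing Implicit Defensive.

Import GRing.Theory.

Local Open Scope ring_scope.
Local Open Scope quotient_scope.

Section QuotientModule.
Variables (R : pzRingType) (V : lmodType R) (S : submodClosed V).

Fact submod_oppr_closed : oppr_closed (S : {pred V}).
Proof. by move=> x Sx; rewrite -scaleN1r rpredZ. Qed.

Definition zmod_of_submod : zmodClosed V :=
  HB.pack_for (zmodClosed V) (@GRing.SubmodClosed.sort R V S)
    (GRing.isOppClosed.Build V (@GRing.SubmodClosed.sort R V S) submod_oppr_closed).

Definition quotmod : Type := Quotient.quot zmod_of_submod.

HB.instance Definition _ :=
  GRing.Zmodule.copy quotmod (Quotient.quot zmod_of_submod).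
HB.instance Definition _ :=
  EqQuotient.copy quotmod (Quotient.quot zmod_of_submod).

Definition quotmod_pi (x : V) : quotmod := \pi_quotmod x.

Definition quotmod_scale (a : R) (x : quotmod) : quotmod :=
  quotmod_pi (a *: repr x).

Fact quotmod_piP (x y : V) :
  reflect (quotmod_pi x = quotmod_pi y) (x - y \in S).
Proof. by apply: (iffP idP) => [Sxy|/eqP]; first apply/eqP; rewrite piE. Qed.

Fact quotmod_reprK (x : quotmod) : quotmod_pi (repr x) = x.
Proof. exact: reprK. Qed.

Fact quotmod_scale_pi a x :
  quotmod_scale a (quotmod_pi x) = quotmod_pi (a *: x).
Proof.
apply/quotmod_piP; rewrite -scalerBr rpredZ //.
by apply/quotmod_piP; rewrite quotmod_reprK.
Qed.

Fact quotmod_pi_add (x y : V) : quotmod_pi x + quotmod_pi y = quotmod_pi (x + y).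
Proof. exact/esym/(@Quotient.pi_add V zmod_of_submod). Qed.

Fact quotmod_scaleA a b v :
  quotmod_scale a (quotmod_scale b v) = quotmod_scale (a * b) v.
Proof. by rewrite -[v]quotmod_reprK !quotmod_scale_pi scalerA. Qed.

Fact quotmod_scale1 : left_id 1 quotmod_scale.
Proof. by move=> v; rewrite -[v]quotmod_reprK quotmod_scale_pi scale1r. Qed.

Fact quotmod_scaleDr : right_distributive quotmod_scale +%R.
Proof.
move=> a u v; rewrite -[u]quotmod_reprK -[v]quotmod_reprK.
by rewrite !(quotmod_pi_add, quotmod_scale_pi) scalerDr.
Qed.

Fact quotmod_scaleDl v : {morph quotmod_scale^~ v : a b / a + b}.
Proof.
by move=> a b; rewrite -[v]quotmod_reprK !quotmod_scale_pi quotmod_pi_add scalerDl.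
Qed.

HB.instance Definition _ := GRing.Zmodule_isLmodule.Build R quotmod
  quotmod_scaleA quotmod_scale1 quotmod_scaleDr quotmod_scaleDl.

End QuotientModule.

Arguments quotmod {R V} S.

(* The direct sum of a finite family of modules, as their product: MathComp
   puts a module structure on non-dependent finite functions only. *)
Section DirectSum.
Variables (R : pzRingType) (I : finType) (V : I -> lmodType R).

Definition dirsum : Type := {dffun forall i : I, V i}.

HB.instance Definition _ := Choice.on dirsum.

Implicit Types f g h : dirsum.

Definition dirsum_zero : dirsum := [ffun i => 0].
Definition dirsum_opp f : dirsum := [ffun i => - f i].
Definition dirsum_add f g : dirsum := [ffun i => f i + g i].
Definition dirsum_scale (a : R) f : dirsum := [ffun i => a *: f i].

Fact dirsum_addA : associative dirsum_add.
Proof. by move=> f g h; apply/ffunP => i; rewrite !ffunE addrA. Qed.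
Fact dirsum_addC : commutative dirsum_add.
Proof. by move=> f g; apply/ffunP => i; rewrite !ffunE addrC. Qed.
Fact dirsum_add0 : left_id dirsum_zero dirsum_add.
Proof. by move=> f; apply/ffunP => i; rewrite !ffunE add0r. Qed.
Fact dirsum_addN : left_inverse dirsum_zero dirsum_opp dirsum_add.
Proof. by move=> f; apply/ffunP => i; rewrite !ffunE addNr. Qed.

HB.instance Definition _ := GRing.isZmodule.Build dirsum
  dirsum_addA dirsum_addC dirsum_add0 dirsum_addN.

Fact dirsum_scaleA a b f :
  dirsum_scale a (dirsum_scale b f) = dirsum_scale (a * b) f.
Proof. by apply/ffunP => i; rewrite !ffunE scalerA. Qed.
Fact dirsum_scale1 : left_id 1 dirsum_scale.
Proof. by move=> f; apply/ffunP => i; rewrite !ffunE scale1r. Qed.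
Fact dirsum_scaleDr : right_distributive dirsum_scale +%R.
Proof. by move=> a f g; apply/ffunP => i; rewrite !ffunE scalerDr. Qed.
Fact dirsum_scaleDl f : {morph dirsum_scale^~ f : a b / a + b}.
Proof. by move=> a b; apply/ffunP => i; rewrite !ffunE scalerDl. Qed.

HB.instance Definition _ := GRing.Zmodule_isLmodule.Build R dirsum
  dirsum_scaleA dirsum_scale1 dirsum_scaleDr dirsum_scaleDl.

End DirectSum.

Definition lmod_iso (R : pzRingType) (U V : lmodType R) : Prop :=
  exists f : {linear U -> V}, bijective f.

Definition proper_submod (R : pzRingType) (V : lmodType R) (S : submodClosed V)
    : Prop :=
  exists v, v \notin S.

Definition torsion_module (R : pzRingType) (V : lmodType R) : Prop :=
  forall v : V, exists2 a : R, a != 0 & a *: v = 0.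

Definition cotorsion (R : pzRingType) (V : lmodType R) (S : submodClosed V)
    : Prop :=
  torsion_module (quotmod S).

(* MathComp's idealr are proper ideals with no product; here an ideal is a
   submodule of the regular module, so that the unit ideal is one. *)
Notation ideal R := (submodClosed R^o).

Section Ideals.
Variable R : comNzRingType.
Implicit Types I J : ideal R.

Definition ideal_nonzero I : Prop := exists2 x, x \in I & x != 0.

Definition prime_ideal I : Prop :=
  1 \notin I /\ prime_idealr_closed (I : {pred R}).

Definition maximal_ideal I : Prop :=
  proper_submod I /\
  forall J, {subset I <= J} -> proper_submod J -> J =i I.

Definition finitely_generated_ideal I : Prop :=
  exists (n : nat) (g : 'I_n -> R),
    forall x, x \in I <-> exists c : 'I_n -> R, x = \sum_(i < n) c i * g i.

Definition ideal1_pred : {pred R^o} := predT.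

Fact ideal1_closed : subsemimod_closed ideal1_pred. Proof. by []. Qed.

HB.instance Definition _ :=
  GRing.isSubSemiModClosed.Build R R^o ideal1_pred ideal1_closed.

Definition ideal1 : ideal R := GRing.SubmodClosed.clone R R^o ideal1_pred _.

Definition idealM_pred I J : {pred R^o} := fun x =>
  `[< exists2 s : seq (R * R),
        {in s, forall p, p.1 \in I /\ p.2 \in J} &
        x = \sum_(p <- s) p.1 * p.2 >].

Fact idealM_closed I J : subsemimod_closed (idealM_pred I J).
Proof.
split; first split.
- by apply/asboolP; exists [::] => //; rewrite big_nil.
- move=> x y /asboolP[s sIJ ->] /asboolP[t tIJ ->]; apply/asboolP.
  exists (s ++ t); last by rewrite big_cat.
  by move=> p; rewrite mem_cat => /orP[/sIJ|/tIJ].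
- move=> a x /asboolP[s sIJ ->]; apply/asboolP.
  exists [seq (a * p.1, p.2) | p <- s].
    move=> _ /mapP[p /sIJ[p1 p2] ->]; split=> //=.
    exact: (@rpredZ R R^o I a p.1 p1).
  rewrite big_map scaler_sumr; apply: eq_bigr => p _.
  exact: mulrA.
Qed.

HB.instance Definition _ I J :=
  GRing.isSubSemiModClosed.Build R R^o (idealM_pred I J) (@idealM_closed I J).

Definition idealM I J : ideal R :=
  GRing.SubmodClosed.clone R R^o (idealM_pred I J) _.

Definition idealX I (n : nat) : ideal R := iter n (idealM I) ideal1.

Definition ideal_prod (r : nat) (J : 'I_r -> ideal R) : ideal R :=
  \big[idealM/ideal1]_(i < r) J i.

End Ideals.

Record dedekind_domain (O : idomainType) : Prop := {
  dedekind_noetherian : forall I : ideal O, finitely_generated_ideal I;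
  dedekind_integrally_closed : forall x : {fraction O},
    integralOver (@tofrac O) x -> exists a : O, x = tofrac a;
  dedekind_dim1 : forall P : ideal O,
    prime_ideal P -> ideal_nonzero P -> maximal_ideal P
}.

Section Invariants.
Variable O : idomainType.

Definition unimodular (p : O * O) : Prop :=
  forall z, exists x y, z = x * p.1 + y * p.2.

(* Points of PF^1_I are taken as equivalence classes, that is, as sets of
   unimodular pairs. *)
Definition PF1_class (I : ideal O) (p : O * O) : set (O * O) :=
  [set q | unimodular q /\ p.1 * q.2 - p.2 * q.1 \in I]%classic.

Definition PF1 (I : ideal O) : set (set (O * O)) :=
  [set c | exists2 p, unimodular p & c = PF1_class I p]%classic.

Notation O2 := (O^o * O^o)%type.
Implicit Type M : submodClosed O2.

(* The elementary maximal ideal divisors m i of M, with their pairs of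
   exponents l i <= k i. *)
Record elementary_divisors M (r : nat) (m : 'I_r -> ideal O)
    (l k : 'I_r -> nat) : Prop := {
  elementary_maximal : forall i, maximal_ideal (m i);
  elementary_distinct : forall i j, m i =i m j -> i = j;
  elementary_le : forall i, (l i <= k i)%N;
  elementary_neq0 : forall i, k i != 0%N;
  elementary_iso : lmod_iso (quotmod M)
    (dirsum (fun i : 'I_r =>
       (quotmod (idealX (m i) (l i)) * quotmod (idealX (m i) (k i)))%type
         : lmodType O))
}.

Definition invariant_factors M (L K : ideal O) : Prop :=
  exists (r : nat) (m : 'I_r -> ideal O) (l k : 'I_r -> nat),
    [/\ elementary_divisors M m l k,
        L =i ideal_prod (fun i => idealX (m i) (l i)) &
        K =i ideal_prod (fun i => idealX (m i) (k i))].

(* c is the class of a pair (a, b) as in the definition of the projective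
   space invariant element, and of every such pair. *)
Definition projective_invariant M (c : set (O * O)) : Prop :=
  exists (r : nat) (m : 'I_r -> ideal O) (l k : 'I_r -> nat),
    elementary_divisors M m l k /\
    let L := ideal_prod (fun i => idealX (m i) (l i)) in
    let I := ideal_prod (fun i => idealX (m i) (k i - l i)) in
    let admissible (p : O * O) := unimodular p /\
      exists t : O, [/\ t \in L, forall i, t \notin idealM L (m i) &
                        (t * p.1, t * p.2) \in M] in
    (exists p, admissible p) /\
    forall p, admissible p -> PF1_class I p = c.

End Invariants.

(* Main.v *)
From HB Require Import structures.
Require Import Defs.
From mathcomp Require Import all_boot all_algebra ring.
From mathcomp Require Import boolp classical_sets.

(** Fix a representative (a, b) of the given point and x, y with
    x a + y b = 1.  In the basis (a, b), (- y, x) of O ^ 2 the submodule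
    M = L (a, b) + K (- y, x) has quotient O / L + O / K.  Factoring L and I
    over a common family of maximal ideals and applying the Chinese remainder
    theorem turns this into the elementary divisor decomposition, the exponent
    of K being the sum of those of L and I.  If t is in L but in no L m_i and
    (t p, t q) is in M, then t (a q - b p) is in K = L I; since t = L J with J
    prime to every m_i, cancelling L gives a q - b p in I.

    The ideal theory of O is the classical one: a nonzero ideal contains a
    product of maximal ideals, which yields for every nonzero maximal ideal P a
    fraction b / a outside O with (b / a) P inside O; integral closure then
    makes P invertible and lets Noetherian induction factor every ideal. *)

Set Implicit Arguments.
Unset Strict Implicit.
Unset Printing Implicit Defensive.

Import GRing.Theory.

Local Open Scope ring_scope.

(** The closure proofs are propositions, so only the carrier matters. Leibniz equality lets ideals
    be rewritten and form a monoid under [idealM]. *)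
Lemma submod_ext (R : pzSemiRingType) (V : lSemiModType R)
    (S T : submodClosed V) : S =i T -> S = T.
Proof.
case: S T => [S [[cS1] [cS2]]] [T [[cT1] [cT2]]] /= eqST.
have {eqST} : S = T by apply/funext => x; have := eqST x; rewrite !unfold_in.
move=> eqST; case: T / eqST cT1 cT2 => cT1 cT2.
by rewrite (Prop_irrelevance cT1 cS1) (Prop_irrelevance cT2 cS2).
Qed.

(** * Ideals of a commutative ring *)

Section IdealArithmetic.
Variable R : comNzRingType.
Implicit Types (I J A P Q : ideal R) (a b x y z : R).

Lemma ideal_mull I a x : x \in I -> a * x \in I.
Proof. exact: (@rpredZ R R^o I a x). Qed.

Lemma ideal_mulr I a x : x \in I -> x * a \in I.
Proof. by rewrite mulrC; apply: ideal_mull. Qed.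

Lemma ideal_add I x y : x \in I -> y \in I -> x + y \in I.
Proof. exact: (@rpredD R^o I). Qed.

Lemma ideal_opp I x : x \in I -> - x \in I.
Proof. by rewrite -mulN1r; apply: ideal_mull. Qed.

Lemma ideal_sub I x y : x \in I -> y \in I -> x - y \in I.
Proof. by move=> xI yI; apply/ideal_add/ideal_opp. Qed.

Lemma ideal_0 I : 0 \in I.
Proof. exact: (@rpred0 R^o I). Qed.

Lemma ideal_sum I (T : Type) (s : seq T) (P : pred T) (F : T -> R) :
  (forall i, P i -> F i \in I) -> \sum_(i <- s | P i) F i \in I.
Proof. exact: (@rpred_sum R^o I). Qed.

Lemma ideal_sub_anti I J : {subset I <= J} -> {subset J <= I} -> I = J.
Proof. by move=> IJ JI; apply: submod_ext => x; apply/idP/idP => [/IJ|/JI]. Qed.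

Lemma eq_ideal1 I : 1 \in I -> I = ideal1 R.
Proof.
move=> I1; apply: ideal_sub_anti => // x _.
by rewrite -[x]mulr1; apply: ideal_mull.
Qed.

Lemma proper_submodP I : proper_submod I <-> 1 \notin I.
Proof.
split=> [[x xI]|]; last by exists 1.
by apply: contra xI => I1; rewrite -[x]mulr1; apply: ideal_mull.
Qed.

Lemma mem_idealM I J x y : x \in I -> y \in J -> x * y \in idealM I J.
Proof.
move=> xI yJ; apply/asboolP; exists [:: (x, y)]; last by rewrite big_seq1.
by move=> p; rewrite inE => /eqP->.
Qed.

Lemma idealM_ind I J (S : ideal R) :
  (forall x y, x \in I -> y \in J -> x * y \in S) -> {subset idealM I J <= S}.
Proof.
move=> IJS x /asboolP[s sP ->]; rewrite big_seq; apply: ideal_sum => p /sP[].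
exact: IJS.
Qed.

Lemma idealMC : commutative (@idealM R).
Proof.
suff sub I J : {subset idealM I J <= idealM J I}.
  by move=> I J; apply: ideal_sub_anti.
by apply: idealM_ind => x y xI yJ; rewrite mulrC mem_idealM.
Qed.

Lemma idealM_subl I J : {subset idealM I J <= I}.
Proof. by apply: idealM_ind => x y xI _; apply: ideal_mulr. Qed.

Lemma idealM_subr I J : {subset idealM I J <= J}.
Proof. by rewrite idealMC; apply: idealM_subl. Qed.

Lemma idealMS I I' J J' :
  {subset I <= I'} -> {subset J <= J'} -> {subset idealM I J <= idealM I' J'}.
Proof.
by move=> sI sJ; apply: idealM_ind => x y /sI xI /sJ; apply: mem_idealM.
Qed.

Section Colon.
Variables (J : ideal R) (a : R).
(** The ideal quotient (J : a). Reading [a * x \in J] as membership of x in an ideal makes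
    [idealM_ind] applicable to x. *)
Definition colon_pred : {pred R^o} := fun z => a * (z : R) \in J.
Fact colon_closed : subsemimod_closed colon_pred.
Proof.
split; first split; rewrite /colon_pred.
- by rewrite unfold_in mulr0 ideal_0.
- by move=> x y; rewrite !unfold_in mulrDr; apply: ideal_add.
- by move=> b x; rewrite !unfold_in => ?; rewrite mulrCA; apply: ideal_mull.
Qed.
HB.instance Definition _ :=
  GRing.isSubSemiModClosed.Build R R^o colon_pred colon_closed.
Definition colon : ideal R := GRing.SubmodClosed.clone R R^o colon_pred _.
Lemma colonE x : (x \in colon) = (a * x \in J).
Proof. by []. Qed.
End Colon.

Lemma idealMA : associative (@idealM R).
Proof.
suff sub I J A : {subset idealM I (idealM J A) <= idealM (idealM I J) A}.
  move=> I J A; apply: ideal_sub_anti; first exact: sub.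
  rewrite (idealMC _ A) (idealMC I) => x /sub.
  by rewrite (idealMC _ I) (idealMC A).
apply: idealM_ind => x y xI yJA; rewrite -colonE; move: y yJA.
by apply: idealM_ind => y z yJ zA; rewrite colonE mulrA !mem_idealM.
Qed.

Lemma idealM1 : left_id (@ideal1 R) (@idealM R).
Proof.
move=> I; apply: ideal_sub_anti; first exact: idealM_subr.
by move=> x xI; rewrite -[x]mul1r mem_idealM.
Qed.

(** With this structure the big operator lemmas apply to products of ideals. *)
HB.instance Definition _ :=
  Monoid.isComLaw.Build (ideal R) (@ideal1 R) (@idealM R)
    idealMA idealMC idealM1.

Section Sum.
Variables I J : ideal R.
Definition idealD_pred : {pred R^o} := fun z =>
  `[< exists2 y : R, y \in J & (z : R) - y \in I >].
Fact idealD_closed : subsemimod_closed idealD_pred.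
Proof.
split; first split; rewrite /idealD_pred.
- by apply/asboolP; exists 0; rewrite ?subr0 ideal_0.
- move=> x y /asboolP[x' x'J xI] /asboolP[y' y'J yI]; apply/asboolP.
  exists (x' + y'); first exact: ideal_add.
  by rewrite opprD addrACA; apply: ideal_add.
- move=> b x /asboolP[x' x'J xI]; apply/asboolP; exists (b * x').
    exact: ideal_mull.
  by rewrite -mulrBr; apply: ideal_mull.
Qed.
HB.instance Definition _ :=
  GRing.isSubSemiModClosed.Build R R^o idealD_pred idealD_closed.
Definition idealD : ideal R := GRing.SubmodClosed.clone R R^o idealD_pred _.
Lemma idealDP x :
  reflect (exists2 y : R, y \in J & x - y \in I) (x \in idealD).
Proof. exact: asboolP. Qed.
End Sum.

Lemma idealD_subl I J : {subset I <= idealD I J}.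
Proof. by move=> x xI; apply/idealDP; exists 0; rewrite ?ideal_0 ?subr0. Qed.

Lemma idealD_subr I J : {subset J <= idealD I J}.
Proof. by move=> x xJ; apply/idealDP; exists x; rewrite ?subrr ?ideal_0. Qed.

Section Scale.
Variables (a : R) (J : ideal R).
Definition idealZ_pred : {pred R^o} := fun z =>
  `[< exists2 y : R, y \in J & (z : R) = a * y >].
Fact idealZ_closed : subsemimod_closed idealZ_pred.
Proof.
split; first split; rewrite /idealZ_pred.
- by apply/asboolP; exists 0; rewrite ?mulr0 ?ideal_0.
- move=> _ _ /asboolP[x xJ ->] /asboolP[y yJ ->]; apply/asboolP.
  by exists (x + y); rewrite ?mulrDr ?ideal_add.
- move=> b _ /asboolP[x xJ ->]; apply/asboolP.
  by exists (b * x); [apply: ideal_mull | apply: mulrCA].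
Qed.
HB.instance Definition _ :=
  GRing.isSubSemiModClosed.Build R R^o idealZ_pred idealZ_closed.
Definition idealZ : ideal R := GRing.SubmodClosed.clone R R^o idealZ_pred _.
Lemma idealZP x : reflect (exists2 y : R, y \in J & x = a * y) (x \in idealZ).
Proof. exact: asboolP. Qed.
End Scale.

Definition principal a := idealZ a (ideal1 R).

Lemma principalP a x : reflect (exists y, x = y * a) (x \in principal a).
Proof.
apply: (iffP (idealZP _ _ _)) => [[y _ ->]|[y ->]]; exists y => //;
  exact: mulrC.
Qed.

Lemma principal_id a : a \in principal a.
Proof. by apply/principalP; exists 1; rewrite mul1r. Qed.

Lemma mem_idealZ a I x : x \in I -> a * x \in idealZ a I.
Proof. by move=> xI; apply/idealZP; exists x. Qed.

Lemma principal_sub a I : a \in I -> {subset principal a <= I}.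
Proof. by move=> aI _ /principalP[y ->]; apply: ideal_mull. Qed.

Lemma idealM_idealZ a I J : idealM (idealZ a I) J = idealZ a (idealM I J).
Proof.
apply: ideal_sub_anti.
  apply: idealM_ind => _ y /idealZP[x xI ->] yJ.
  by rewrite -mulrA mem_idealZ ?mem_idealM.
move=> _ /idealZP[z zIJ ->]; rewrite -colonE; move: z zIJ.
by apply: idealM_ind => x y xI yJ; rewrite colonE mulrA mem_idealM ?mem_idealZ.
Qed.

Lemma idealM_principal a J : idealM (principal a) J = idealZ a J.
Proof. by rewrite idealM_idealZ idealM1. Qed.

Lemma principalM a b :
  idealM (principal a) (principal b) = principal (a * b).
Proof.
rewrite idealM_principal; apply: ideal_sub_anti => x.
  case/idealZP=> _ /principalP[z ->] ->.
  by rewrite mulrCA; apply/principalP; exists z.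
by case/principalP=> z ->; rewrite mulrCA mem_idealZ ?ideal_mull ?principal_id.
Qed.

Lemma idealZ_colon a J : {subset J <= principal a} -> idealZ a (colon J a) = J.
Proof.
move=> Ja; apply: ideal_sub_anti; first by move=> _ /idealZP[y yJ ->].
move=> x /[dup] xJ /Ja /idealZP[y _ xE]; apply/idealZP; exists y => //.
by rewrite colonE -xE.
Qed.

Lemma prime_idealM P I J : prime_ideal P ->
  {subset idealM I J <= P} -> {subset I <= P} \/ {subset J <= P}.
Proof.
move=> [_ primeP] IJP; have [IP|/existsNP[x]] := pselect {subset I <= P}.
  by left.
move=> /not_implyP[xI /negP xP]; right=> y yJ.
have /primeP : x * y \in P by apply/IJP/mem_idealM.
by rewrite (negPf xP).
Qed.

Lemma maximal_prime P : maximal_ideal P -> prime_ideal P.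
Proof.
move=> [/proper_submodP P1 maxP]; split=> // x y xyP.
apply/negPn/negP; rewrite negb_or => /andP[xP yP].
pose J := idealD P (principal x).
have PJ : {subset P <= J} by apply: idealD_subl.
have xJ : x \in J by apply/idealD_subr/principal_id.
have [J1|/proper_submodP/(maxP _ PJ) eqJP] := boolP (1 \in J); last first.
  by rewrite -eqJP xJ in xP.
have [_ /principalP[z ->] zP] := idealDP _ _ _ J1.
(* By maximality P + (x) is the unit ideal, so 1 - z x lies in P for some z; multiplying by y puts y
   in P. *)
case/negP: yP; have -> : y = y * (1 - z * x) + z * (x * y) by ring.
by apply: ideal_add; apply: ideal_mull.
Qed.

Lemma maximal_sub_eq P Q : maximal_ideal P -> maximal_ideal Q ->
  {subset P <= Q} -> P = Q.
Proof.
by move=> [_ maxP] [properQ _] /maxP/(_ properQ) eqQP; apply/esym/submod_ext.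
Qed.

(** I + J = R, recorded by a splitting of 1. *)
Definition comaximal I J := exists2 x, x \in I & 1 - x \in J.

Lemma comaximalC I J : comaximal I J -> comaximal J I.
Proof. by move=> [x xI xJ]; exists (1 - x) => //; rewrite subKr. Qed.

Lemma comaximal1 I : comaximal I (ideal1 R).
Proof. by exists 0; rewrite ?ideal_0. Qed.

Lemma comaximalM I J A :
  comaximal I J -> comaximal I A -> comaximal I (idealM J A).
Proof.
(* The product of 1 - x in J and 1 - y in A is the part of 1 lying in J A. *)
move=> [x xI xJ] [y yI yA]; exists (1 - (1 - x) * (1 - y)).
  have -> : 1 - (1 - x) * (1 - y) = x + (1 - x) * y by ring.
  by rewrite ideal_add ?ideal_mull.
by rewrite subKr mem_idealM.
Qed.

Lemma comaximalX I J n : comaximal I J -> comaximal I (idealX J n).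
Proof.
move=> coIJ; elim: n => [|n IHn]; [exact: comaximal1 | exact: comaximalM].
Qed.

Lemma comaximal_prod (T : Type) (s : seq T) (P : pred T) (F : T -> ideal R) I :
  (forall i, P i -> comaximal I (F i)) ->
  comaximal I (\big[@idealM R/ideal1 R]_(i <- s | P i) F i).
Proof.
move=> coIF; apply: (big_ind (comaximal I)) => //; first exact: comaximal1.
exact: comaximalM.
Qed.

Lemma comaximalI I J x :
  comaximal I J -> x \in I -> x \in J -> x \in idealM I J.
Proof.
move=> [y yI yJ] xI xJ; have -> : x = y * x + x * (1 - y) by ring.
by rewrite ideal_add ?mem_idealM.
Qed.

Lemma maximal_comaximal P I : maximal_ideal P -> ~ {subset I <= P} ->
  comaximal I P.
Proof.
move=> [_ maxP] /existsNP[x /not_implyP[xI /negP xP]].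
have PD : {subset P <= idealD I P} by apply: idealD_subr.
have [D1|/proper_submodP/(maxP _ PD) eqDP] := boolP (1 \in idealD I P).
  by have [y yP yI] := idealDP _ _ _ D1; exists (1 - y); rewrite ?subKr.
by move: xP; rewrite -eqDP idealD_subl.
Qed.

(** Each Q i is comaximal with the product of the others, which gives e i congruent to 1 modulo Q i
    and to 0 modulo every other Q j; the solution is the sum of the z i * e i. *)
Lemma chinese_remainder r (Q : 'I_r -> ideal R) (z : 'I_r -> R) :
  (forall i j, i != j -> comaximal (Q i) (Q j)) ->
  exists x, forall i, x - z i \in Q i.
Proof.
move=> coQ.
have coQi i : comaximal (Q i) (\big[@idealM R/ideal1 R]_(j | j != i) Q j).
  by apply: comaximal_prod => j ji; apply: coQ; rewrite eq_sym.
have eP0 i : exists x, 1 - x \in Q i /\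
    x \in \big[@idealM R/ideal1 R]_(j | j != i) Q j.
  by have [x xQ xj] := coQi i; exists (1 - x); rewrite subKr.
have [e eP] := choice eP0.
exists (\sum_i z i * e i) => i; rewrite (bigD1 i) //= addrAC.
have -> : z i * e i - z i = - (z i * (1 - e i)) by ring.
apply: ideal_add; first by apply/ideal_opp/ideal_mull; case: (eP i).
apply: ideal_sum => j ji; apply: ideal_mull.
have [_] := eP j; rewrite (bigD1 i) 1?eq_sym //; exact: idealM_subl.
Qed.

Lemma ideal_prodP r (Q : 'I_r -> ideal R) x :
  (forall i j, i != j -> comaximal (Q i) (Q j)) ->
  x \in ideal_prod Q <-> forall i, x \in Q i.
Proof.
move=> coQ; rewrite /ideal_prod; split=> [xQ i|xQ].
  by move: xQ; rewrite (bigD1 i) //=; apply: idealM_subl.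
(* Uniqueness of the enumeration is carried along, since comaximality is only known for distinct
   indices. *)
elim: (index_enum _) (index_enum_uniq 'I_r) => [|i s IHs].
  by rewrite big_nil.
rewrite big_cons /= => /andP[si /IHs xs]; apply: comaximalI => //.
rewrite big_seq; apply: comaximal_prod => j js; apply: coQ.
by apply: contraNneq si => ->.
Qed.

End IdealArithmetic.

Lemma idealZ_sub (R : idomainType) (a : R) (I J : ideal R) : a != 0 ->
  {subset idealZ a I <= idealZ a J} -> {subset I <= J}.
Proof.
move=> a0 IJ x /(mem_idealZ a)/IJ/idealZP[y yJ] /(mulfI a0) ->; exact: yJ.
Qed.

Lemma idealZ_inj (R : idomainType) (a : R) : a != 0 -> injective (idealZ a).
Proof.
move=> a0 I J eqIJ.
by apply: ideal_sub_anti; apply: (idealZ_sub a0); rewrite eqIJ.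
Qed.

(** * Noetherian induction *)

Lemma generator_in (R : comNzRingType) (I : ideal R) n (g : 'I_n -> R) :
  (forall x, x \in I <-> exists c : 'I_n -> R, x = \sum_(i < n) c i * g i) ->
  forall i, g i \in I.
Proof.
move=> gP i; apply/gP; exists (fun j => (j == i)%:R).
rewrite (bigD1 i) //= eqxx mul1r big1 ?addr0 // => j /negPf->.
by rewrite mul0r.
Qed.

Section ChainUnion.
Variables (R : comNzRingType) (u : nat -> ideal R).
Hypothesis u_le : forall n, {subset u n <= u n.+1}.

Lemma chain_le n k : (n <= k)%N -> {subset u n <= u k}.
Proof.
move=> /subnK <-; elim: (k - n)%N => [|d IHd] x //.
by move=> /IHd; apply: u_le.
Qed.

Definition chain_pred : {pred R^o} := fun x => `[< exists n, x \in u n >].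

Fact chain_closed : subsemimod_closed chain_pred.
Proof.
split; first split.
- by apply/asboolP; exists 0%N; apply: ideal_0.
- move=> x y /asboolP[n xn] /asboolP[k yk]; apply/asboolP; exists (maxn n k).
  by apply: ideal_add; [move: xn|move: yk]; apply: chain_le;
    rewrite ?leq_maxl ?leq_maxr.
- by move=> a x /asboolP[n xn]; apply/asboolP; exists n; apply: ideal_mull.
Qed.

HB.instance Definition _ :=
  GRing.isSubSemiModClosed.Build R R^o chain_pred chain_closed.

Definition chain_union : ideal R := GRing.SubmodClosed.clone R R^o chain_pred _.

(** The finitely many generators of the union all lie in one u N, which is then the whole union. *)
Lemma chain_stationary :
  finitely_generated_ideal chain_union -> exists n, u n.+1 = u n.
Proof.
move=> [r [g gP]].
have gU i : exists n, g i \in u n.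
  exact/asboolP/(generator_in gP i).
have [N NP] := choice gU; exists (\max_i N i)%N.
apply: ideal_sub_anti; last exact: u_le.
move=> x xu; have /gP[c ->] : x \in chain_union.
  by apply/asboolP; eexists; exact: xu.
apply: ideal_sum => i _; apply/ideal_mull/(chain_le _ (NP i)).
exact: (leq_bigmax i).
Qed.

End ChainUnion.

(** If S failed at some ideal, every counterexample would have a strictly larger one, and choice
    would iterate this into a chain that never becomes stationary. *)
Lemma noetherian_ind (R : comNzRingType) (S : ideal R -> Prop) :
  (forall I : ideal R, finitely_generated_ideal I) ->
  (forall I : ideal R,
    (forall J : ideal R, {subset I <= J} -> J <> I -> S J) -> S I) ->
  forall I, S I.
Proof.
move=> noeth indS I0; apply: contrapT => nSI0.
have step (w : {I | ~ S I}) :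
    exists w' : {I | ~ S I}, {subset sval w <= sval w'} /\ sval w' <> sval w.
  case: w => I nSI /=; apply: contrapT => nw'; apply/nSI/indS => J IJ neqJI.
  by apply: contrapT => nSJ; apply: nw'; exists (exist _ J nSJ).
have [f fP] := choice step.
pose u n := sval (iter n f (exist _ I0 nSI0)).
have [] := @chain_stationary _ u (fun n => (fP _).1) (noeth _).
by move=> n; apply: (fP _).2.
Qed.

Lemma exists_maximal (R : comNzRingType) (I : ideal R) :
  (forall I : ideal R, finitely_generated_ideal I) -> proper_submod I ->
  exists2 P : ideal R, maximal_ideal P & {subset I <= P}.
Proof.
move=> noeth; elim/(@noetherian_ind R): I => // I IHI properI.
have [maxI|nmaxI] := pselect (maximal_ideal I); first by exists I.
have [J [IJ properJ neqJI]] :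
    exists J : ideal R, [/\ {subset I <= J}, proper_submod J & J <> I].
  apply: contrapT => nJ; apply: nmaxI; split=> // J IJ properJ.
  suff -> : J = I by [].
  by apply: contrapT => neqJI; apply: nJ; exists J.
by have [P maxP JP] := IHI J IJ neqJI properJ; exists P => // x /IJ/JP.
Qed.

(** * Ideal theory of a Dedekind domain *)

Section Dedekind.
Variables (O : idomainType) (dedO : dedekind_domain O).
Implicit Types (I J L P Q : ideal O) (a b x y : O).

(** The determinant trick: b / a stabilises L, so it is an eigenvalue of a matrix over O acting on
    generators of L. It is a root of the monic characteristic polynomial, hence integral, hence in
    O. *)
Lemma integral_multiplier L a b : ideal_nonzero L -> a != 0 ->
  (forall x, x \in L -> b * x \in idealZ a L) -> b \in principal a.
Proof.
move=> [x0 x0L x0neq0] a0 bL; have [n [g gP]] := dedekind_noetherian dedO L.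
have gL := generator_in gP.
have bg i : exists c : 'I_n -> O, b * g i = a * \sum_j c j * g j.
  by have /idealZP[_ /gP[c ->] ->] := bL _ (gL i); exists c.
have [c cP] := choice bg.
(* Transposed because [eigenvalue] refers to row vectors. *)
pose A := (\matrix_(i, j) c i j)^T.
pose v := \row_i tofrac (g i).
have ta0 : tofrac a != 0 by rewrite tofrac_eq0.
have vA : v *m map_mx (@tofrac O) A = (tofrac b / tofrac a) *: v.
  apply/rowP => i; rewrite !mxE mulrAC -tofracM cP tofracM mulrAC.
  rewrite divff // mul1r.
  rewrite rmorph_sum /=; apply: eq_bigr => j _.
by rewrite !mxE rmorphM mulrC.
have v0 : v != 0.
  apply: contraNneq x0neq0 => v0; have [d ->] := (gP x0).1 x0L.
  rewrite big1 // => i _; have /rowP/(_ i) := v0.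
  by rewrite !mxE => /eqP; rewrite tofrac_eq0 => /eqP->; rewrite mulr0.
have : eigenvalue (map_mx (@tofrac O) A) (tofrac b / tofrac a).
  by apply/eigenvalueP; exists v.
rewrite eigenvalue_root_char -map_char_poly => rootA.
have [|d dE] := dedekind_integrally_closed dedO (x := tofrac b / tofrac a).
  by exists (char_poly A); rewrite ?char_poly_monic.
apply/principalP; exists d; apply/eqP; rewrite -tofrac_eq tofracM -dE.
by rewrite divfK.
Qed.

(** The index counts the factors, so that a shortest product can be chosen in
    [maximal_denominator]. *)
Inductive maximal_product : nat -> ideal O -> Prop :=
| Maximal_product0 : maximal_product 0 (ideal1 O)
| Maximal_productS n P J : maximal_ideal P -> maximal_product n J ->
    maximal_product n.+1 (idealM P J).

Lemma maximal_productM n k I J : maximal_product n I -> maximal_product k J ->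
  maximal_product (n + k) (idealM I J).
Proof.
move=> prodI prodJ; elim: prodI => [|{}n P A maxP _ IHA].
  by rewrite idealM1.
by rewrite -idealMA addSn; apply: Maximal_productS.
Qed.

(** P is prime, so it contains one of the factors, and equals it because that factor is maximal. *)
Lemma maximal_product_factor n P J : maximal_ideal P -> maximal_product n J ->
  {subset J <= P} -> exists k J',
  [/\ n = k.+1, maximal_product k J' & J = idealM P J'].
Proof.
move=> maxP; have [P1 _] := maximal_prime maxP.
elim=> [|{}n Q A maxQ prodA IHA] sub; first by rewrite (sub 1) in P1.
have [QP|AP] := prime_idealM (maximal_prime maxP) sub.
  by exists n, A; rewrite (maximal_sub_eq maxQ maxP QP).
have [k [A' [-> prodA' ->]]] := IHA AP.
exists k.+1, (idealM Q A'); split=> //; first exact: Maximal_productS.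
by rewrite !idealMA (idealMC Q).
Qed.

(** Noetherian induction: if I is proper and not prime, take x y in I with x and y outside I. Both I
    + (x) and I + (y) contain products of maximal ideals, and their own product lies in I. *)
Lemma maximal_product_sub I : ideal_nonzero I ->
  exists n J, maximal_product n J /\ {subset J <= I}.
Proof.
elim/(@noetherian_ind O): I => [|I IHI]; first exact: dedekind_noetherian.
move=> nzI; have nzS (J : ideal O) : {subset I <= J} -> ideal_nonzero J.
  by case: nzI => x xI x0 /(_ x xI); exists x.
have [I1|I1] := boolP (1 \in I).
  exists 0, (ideal1 O); rewrite (eq_ideal1 I1); split=> //.
  exact: Maximal_product0.
have [primeI|] := pselect (prime_ideal I).
  exists 1, (idealM I (ideal1 O)); split; last exact: idealM_subl.
  apply: Maximal_productS; last exact: Maximal_product0.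
  exact: dedekind_dim1.
move=> /not_andP[//|/existsNP[x /existsNP[y /not_implyP[xyI]]]].
move=> /negP; rewrite negb_or => /andP[xI yI].
have grow z : z \notin I ->
    exists n J, maximal_product n J /\ {subset J <= idealD I (principal z)}.
  move=> zI; apply: IHI; first exact: idealD_subl.
    move=> eqI; case/negP: zI; rewrite -eqI.
    exact/idealD_subr/principal_id.
  exact/nzS/idealD_subl.
have [[n [A [prodA Ax]]] [k [B [prodB By]]]] := (grow x xI, grow y yI).
exists (n + k), (idealM A B); split; first exact: maximal_productM.
move=> z /(idealMS Ax By); move: z.
apply: idealM_ind => x' y' /idealDP[_ /principalP[c ->] xc].
move=> /idealDP[_ /principalP[d ->] yd].
have -> : x' * y' =
    y' * (x' - c * x) + (c * x) * (y' - d * y) + (c * d) * (x * y).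
  by ring.
by do 2?apply: ideal_add; apply: ideal_mull.
Qed.

(** The inverse of L is the fractional ideal L' / a; clearing the denominator keeps everything
    inside O. *)
Definition invertible_ideal L := exists (L' : ideal O) (a : O),
  a != 0 /\ idealM L L' = principal a.

Lemma invertible_sub L I J : invertible_ideal L ->
  {subset idealM L I <= idealM L J} -> {subset I <= J}.
Proof.
move=> [L' [a [a0 LL']]] LIJ; apply: (idealZ_sub a0).
rewrite -!idealM_principal -LL' (idealMC L) -!idealMA.
exact: idealMS.
Qed.

Lemma invertibleM I J :
  invertible_ideal I -> invertible_ideal J -> invertible_ideal (idealM I J).
Proof.
move=> [I' [a [a0 II']]] [J' [b [b0 JJ']]].
exists (idealM I' J'), (a * b); split; first by rewrite mulf_neq0.
by rewrite Monoid.mulmACA /= II' JJ' principalM.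
Qed.

(** The quotient is (1 / a) I L', which lies in O because I L' is contained in L L' = (a). *)
Lemma invertible_dvd L I : invertible_ideal L -> {subset I <= L} ->
  exists J, I = idealM L J.
Proof.
move=> [L' [a [a0 LL']]] IL; exists (colon (idealM I L') a).
apply: (idealZ_inj a0); rewrite (idealMC L) -idealM_idealZ idealZ_colon.
  by rewrite -idealMA (idealMC L') LL' idealMC idealM_principal.
by rewrite -LL'; apply: idealMS.
Qed.

(* N is L (1, b / a): it is larger than L because b / a is not integral over
   O, hence does not stabilise L. *)
Lemma colon_grow L a b : ideal_nonzero L -> a != 0 -> b \notin principal a ->
  (forall x, x \in L -> b * x \in principal a) ->
  let D := idealD (principal a) (principal b) in
  exists N, [/\ idealZ a N = idealM L D, {subset L <= N} & N <> L].
Proof.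
move=> nzL a0 ba bL D.
have aD : a \in D by apply/idealD_subl/principal_id.
have bD : b \in D by apply/idealD_subr/principal_id.
exists (colon (idealM L D) a).
have defN : idealZ a (colon (idealM L D) a) = idealM L D.
  apply: idealZ_colon; apply: idealM_ind => x d xL.
  move=> /idealDP[_ /principalP[c ->] /principalP[e de]].
  have -> : x * d = x * e * a + c * (b * x).
    by rewrite -(subrK (c * b) d) de; ring.
  by apply: ideal_add; [apply/principalP; eexists | apply/ideal_mull/bL].
split=> // [x xL|eqN]; first by rewrite colonE mulrC mem_idealM.
case/negP: ba; apply: integral_multiplier (nzL) (a0) _ => x xL.
by rewrite eqN in defN; rewrite defN mulrC mem_idealM.
Qed.

(** Take a nonzero a in P and a shortest product J of maximal ideals inside (a). Since P contains J,
    J = P J' with J' shorter, so J' is not inside (a). Any b in J' outside (a) satisfies b P <= J <=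
    (a). *)
Lemma maximal_denominator P : maximal_ideal P -> ideal_nonzero P -> exists a b,
  [/\ a != 0, a \in P, b \notin principal a &
      forall x, x \in P -> b * x \in principal a].
Proof.
move=> maxP [a aP a0].
have exn : exists n,
    `[< exists J, maximal_product n J /\ {subset J <= principal a} >].
  have [|n [J]] := @maximal_product_sub (principal a).
    by exists a => //; apply: principal_id.
  by exists n; apply/asboolP; exists J.
case: (ex_minnP exn) => n /asboolP[J [prodJ Ja]] min_n.
have [|k [J' [nE prodJ' JE]]] := maximal_product_factor maxP prodJ.
  by move=> x /Ja; apply: principal_sub.
have /existsNP[b /not_implyP[bJ' /negP ba]] : ~ {subset J' <= principal a}.
  move=> J'a; suff /min_n : `[< exists J, maximal_product k J /\
    {subset J <= principal a} >] by rewrite nE ltnn.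
  by apply/asboolP; exists J'.
exists a, b; split=> // x xP; apply: Ja.
by rewrite JE mulrC mem_idealM.
Qed.

Lemma maximal_invertible P : maximal_ideal P -> ideal_nonzero P ->
  exists a b : O, [/\ a != 0, b \notin principal a,
    forall x, x \in P -> b * x \in principal a &
    idealM P (idealD (principal a) (principal b)) = principal a].
Proof.
move=> maxP nzP; have [a [b [a0 aP ba bP]]] := maximal_denominator maxP nzP.
exists a, b; split=> //.
have [N [defN PN neqN]] := colon_grow nzP a0 ba bP.
(* N strictly contains the maximal ideal P, hence is O, and a N = P (a, b) becomes (a). *)
rewrite -defN /principal; congr (idealZ a _); apply: eq_ideal1.
apply/negPn/negP => /proper_submodP properN; apply: neqN.
exact/submod_ext/maxP.2.
Qed.

(** A proper nonzero L lies in some maximal P, and N, the product of L with the inverse of P, is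
    strictly larger than L with L = P N; Noetherian induction applies to N. *)
Lemma maximal_ideal_ind (S : ideal O -> Prop) :
  S (ideal1 O) ->
  (forall P J, maximal_ideal P -> ideal_nonzero P -> S J -> S (idealM P J)) ->
  forall L, ideal_nonzero L -> S L.
Proof.
move=> S1 SM; elim/(@noetherian_ind O) => [|L IHL nzL].
  exact: dedekind_noetherian.
have [L1|/proper_submodP properL] := boolP (1 \in L).
  by rewrite (eq_ideal1 L1).
have [P maxP LP] := exists_maximal (dedekind_noetherian dedO) properL.
have nzS (J : ideal O) : {subset L <= J} -> ideal_nonzero J.
  by case: nzL => x xL x0 /(_ x xL); exists x.
have [a [b [a0 ba bP defPD]]] := maximal_invertible maxP (nzS _ LP).
have bL x : x \in L -> b * x \in principal a by move/LP/bP.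
have [N [defN LN neqN]] := colon_grow nzL a0 ba bL.
suff -> : L = idealM P N by apply/SM/IHL => //; apply: nzS.
apply: (idealZ_inj a0).
rewrite (idealMC P) -idealM_idealZ defN -idealMA (idealMC _ P) defPD.
by rewrite idealMC idealM_principal.
Qed.

Lemma nonzero_invertible L : ideal_nonzero L -> invertible_ideal L.
Proof.
move: L; apply: maximal_ideal_ind => [|P J maxP nzP invJ].
  exists (ideal1 O), 1; rewrite oner_neq0 idealM1; split=> //.
  exact/esym/eq_ideal1/principal_id.
apply: invertibleM => //.
have [a [b [a0 _ _ defPD]]] := maximal_invertible maxP nzP.
by exists (idealD (principal a) (principal b)), a.
Qed.

(** Zero exponents let A and B share one family; l i + e i > 0 keeps only divisors of A B, as
    nonzero exponents of K will require. *)
Definition common_factors r (m : 'I_r -> ideal O) (l e : 'I_r -> nat) A B :=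
  [/\ forall i, maximal_ideal (m i), injective m, forall i, (0 < l i + e i)%N,
      A = ideal_prod (fun i => idealX (m i) (l i)) &
      B = ideal_prod (fun i => idealX (m i) (e i))].

Lemma idealXD P n k : idealX P (n + k) = idealM (idealX P n) (idealX P k).
Proof. by elim: n => [|n IHn]; rewrite ?idealM1 //= IHn idealMA. Qed.

Lemma common_factorsC r (m : 'I_r -> ideal O) l e A B :
  common_factors m l e A B -> common_factors m e l B A.
Proof. by case=> maxm injm le0 -> ->; split=> // i; rewrite addnC. Qed.

Lemma common_factorsM P A B : maximal_ideal P ->
  (exists r (m : 'I_r -> ideal O) l e, common_factors m l e A B) ->
  exists r (m : 'I_r -> ideal O) l e, common_factors m l e (idealM P A) B.
Proof.
move=> maxP [r [m [l [e [maxm injm le0 -> ->]]]]].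
have [[i miP]|nP] := pselect (exists i, m i = P).
  (* P is already in the family: its exponent in A grows by one. *)
  exists r, m, (fun j => (j == i) + l j)%N, e; split=> //.
    by move=> j; rewrite -addnA addn_gt0 le0 orbT.
  rewrite /ideal_prod (bigD1 i) // [RHS](bigD1 i) //= eqxx add1n /=.
  rewrite -miP idealMA.
  by congr idealM; apply: eq_bigr => j /negPf->.
(* P is new: it enters at index 0 with exponent 1 in A and 0 in B, the old family being shifted. *)
exists r.+1, (fun j => oapp m P (unlift ord0 j)),
  (fun j => oapp l 1%N (unlift ord0 j)),
  (fun j => oapp e 0%N (unlift ord0 j)); split.
- by move=> j; case: unliftP => /=.
- move=> j k; case: unliftP => [j'|] ->; case: unliftP => [k'|] -> //=.
  + by move/injm ->.
  + by move=> mP; case: nP; exists j'.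
  + by move=> mP; case: nP; exists k'; rewrite mP.
- by move=> j; case: unliftP => //= j' _; apply: le0.
- rewrite /ideal_prod [RHS]big_ord_recl unlift_none /= (Monoid.mulm1 _ P).
  by congr idealM; apply: eq_bigr => j _; rewrite liftK.
- rewrite /ideal_prod [RHS]big_ord_recl unlift_none /= idealM1.
  by apply: eq_bigr => j _; rewrite liftK.
Qed.

Lemma common_factorization A B : ideal_nonzero A -> ideal_nonzero B ->
  exists r (m : 'I_r -> ideal O) l e, common_factors m l e A B.
Proof.
(* Induction on B reduces to B = O, induction on A then to A = O, where the family is empty. *)
move=> nzA; move: B; apply: maximal_ideal_ind; last first.
  move=> P J maxP _ [r [m [l [e fm]]]].
  have [|r' [m' [e' [l' fm']]]] := @common_factorsM P J A maxP.
    by exists r, m, e, l; apply: common_factorsC.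
  by exists r', m', l', e'; apply: common_factorsC.
move: A nzA; apply: maximal_ideal_ind; last first.
  by move=> P J maxP _; apply: common_factorsM.
exists 0, (fun=> ideal1 O), (fun=> 0%N), (fun=> 0%N).
by split=> [[]|[]|[]||] //; rewrite /ideal_prod big_ord0.
Qed.

End Dedekind.

(** * Quotient modules *)

Lemma quotmod_piD (R : pzRingType) (V : lmodType R) (S : submodClosed V) a u v :
  quotmod_pi S (a *: u + v) = a *: quotmod_pi S u + quotmod_pi S v.
Proof. by rewrite -quotmod_pi_add -quotmod_scale_pi. Qed.

Lemma quotmod_pi_eq0 (R : pzRingType) (V : lmodType R) (S : submodClosed V) v :
  quotmod_pi S v = 0 <-> v \in S.
Proof.
have <- : quotmod_pi S 0 = 0.
  by rewrite -[RHS](scale0r (quotmod_pi S 0)) [RHS]quotmod_scale_pi scale0r.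
by rewrite -[v in v \in S]subr0; split=> /quotmod_piP.
Qed.

Lemma quotmod_iso (R : pzRingType) (V W : lmodType R) (S : submodClosed V)
    (f : {linear V -> W}) :
  (forall v, (f v = 0) <-> (v \in S)) -> (forall w, exists v, f v = w) ->
  lmod_iso (quotmod S) W.
Proof.
move=> kerf surjf; pose g (q : quotmod S) : W := f (repr q).
have gE v : g (quotmod_pi S v) = f v.
  apply/eqP; rewrite -subr_eq0 -linearB /=; apply/eqP/kerf/quotmod_piP.
  exact: quotmod_reprK.
have g_linear : linear g.
  move=> a u v; rewrite -[u]quotmod_reprK -[v]quotmod_reprK.
  by rewrite -quotmod_piD !gE linearP.
pose G : {linear quotmod S -> W} :=
  HB.pack g (GRing.isLinear.Build R (quotmod S) W *:%R g g_linear).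
have [h hP] := choice surjf.
exists G, (fun w => quotmod_pi S (h w)) => [q|w]; last by rewrite /G /= gE.
rewrite -[RHS]quotmod_reprK; apply/quotmod_piP/kerf.
by rewrite linearB /= hP subrr.
Qed.

(** * The submodule and its quotient *)

Section Lattice.
Variables (O : idomainType) (L K : ideal O) (a b x y : O).
Hypothesis xayb : x * a + y * b = 1.

(* The coordinates of q in the basis (a, b), (- y, x) of O ^ 2. *)
Definition coord1 (q : O^o * O^o) : O := x * q.1 + y * q.2.
Definition coord2 (q : O^o * O^o) : O := a * q.2 - b * q.1.

(** Conditions on coordinates replace generators; [coord2] is also the determinant that defines the
    equivalence with (a, b). *)
Definition lattice_pred : {pred (O^o * O^o)%type} :=
  fun q => (coord1 q \in L) && (coord2 q \in K).

Fact coord1_linear s q r : coord1 (s *: q + r) = s * coord1 q + coord1 r.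
Proof.
have -> : s *: q + r = (s * q.1 + r.1, s * q.2 + r.2) by [].
by rewrite /coord1 /=; ring.
Qed.

Fact coord2_linear s q r : coord2 (s *: q + r) = s * coord2 q + coord2 r.
Proof.
have -> : s *: q + r = (s * q.1 + r.1, s * q.2 + r.2) by [].
by rewrite /coord2 /=; ring.
Qed.

Fact lattice_closed : subsemimod_closed lattice_pred.
Proof.
have lat0 : 0 \in lattice_pred.
  by rewrite unfold_in /coord1 /coord2 /= !mulr0 addr0 subr0 !ideal_0.
have latP s q r : q \in lattice_pred -> r \in lattice_pred ->
    s *: q + r \in lattice_pred.
  rewrite !unfold_in coord1_linear coord2_linear => /andP[q1 q2] /andP[r1 r2].
  by apply/andP; split; apply: ideal_add => //; apply: ideal_mull.
split; first split=> // q r qM rM.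
  by rewrite -[q]scale1r; apply: latP.
by move=> s q qM; rewrite -[_ *: _]addr0; apply: latP.
Qed.

HB.instance Definition _ := GRing.isSubSemiModClosed.Build O (O^o * O^o)%type
  lattice_pred lattice_closed.

Definition lattice : submodClosed (O^o * O^o)%type :=
  GRing.SubmodClosed.clone O (O^o * O^o)%type lattice_pred _.

Lemma latticeE q : (q \in lattice) = (coord1 q \in L) && (coord2 q \in K).
Proof. by []. Qed.

Lemma coord_surj (s t : O) : exists q, coord1 q = s /\ coord2 q = t.
Proof.
exists (s * a - t * y, s * b + t * x); rewrite /coord1 /coord2 /=; split.
  by rewrite -[RHS]mulr1 -xayb; ring.
by rewrite -[RHS]mulr1 -xayb; ring.
Qed.

(** The map reduces both coordinates modulo each A i and B i. Its kernel is the lattice since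
    comaximal products are intersections; it is onto by one Chinese remainder per coordinate. *)
Lemma lattice_iso r (A B : 'I_r -> ideal O) :
  (forall i j, i != j -> comaximal (A i) (A j)) ->
  (forall i j, i != j -> comaximal (B i) (B j)) ->
  L = ideal_prod A -> K = ideal_prod B ->
  lmod_iso (quotmod lattice)
    (dirsum (fun i : 'I_r =>
       (quotmod (A i) * quotmod (B i))%type : lmodType O)).
Proof.
move=> coA coB LE KE.
pose f (q : O^o * O^o) :
    dirsum (fun i : 'I_r =>
      (quotmod (A i) * quotmod (B i))%type : lmodType O) :=
  [ffun i => (quotmod_pi (A i) (coord1 q), quotmod_pi (B i) (coord2 q))].
have f_linear : linear f.
  move=> s q q'; apply/ffunP => i; rewrite !ffunE.
  rewrite coord1_linear coord2_linear.
  exact: (congr2 pair (quotmod_piD (A i) _ _ _) (quotmod_piD (B i) _ _ _)).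
pose F : {linear (O^o * O^o)%type -> _} :=
  HB.pack f (GRing.isLinear.Build O _ _ *:%R f f_linear).
apply: (@quotmod_iso O _ _ lattice F) => [q|w].
  rewrite latticeE LE KE; split=> [/ffunP Fq0|/andP[q1 q2]].
    apply/andP; split; apply/ideal_prodP => // i; apply/quotmod_pi_eq0.
      by have /(congr1 fst) := Fq0 i; rewrite !ffunE.
    by have /(congr1 snd) := Fq0 i; rewrite !ffunE.
  apply/ffunP => i; rewrite !ffunE; congr (_, _); apply/quotmod_pi_eq0.
    by move: i; apply/ideal_prodP.
  by move: i; apply/ideal_prodP.
have [s sP] := chinese_remainder (fun i => repr (w i).1 : O) coA.
have [t tP] := chinese_remainder (fun i => repr (w i).2 : O) coB.
have [q [q1 q2]] := coord_surj s t; exists q; apply/ffunP => i; rewrite !ffunE.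
rewrite q1 q2 [RHS]surjective_pairing; congr (_, _).
  by rewrite -[RHS]quotmod_reprK; apply/quotmod_piP.
by rewrite -[RHS]quotmod_reprK; apply/quotmod_piP.
Qed.

Lemma lattice_cotorsion :
  ideal_nonzero K -> {subset K <= L} -> cotorsion lattice.
Proof.
(* A single nonzero z of K, which also lies in L, annihilates the whole quotient. *)
move=> [z zK z0] KL v; exists z => //; rewrite -[v]quotmod_reprK.
rewrite [LHS]quotmod_scale_pi; apply/quotmod_pi_eq0.
set q := repr v; rewrite -[z *: q]addr0 latticeE coord1_linear coord2_linear.
rewrite /coord1 /coord2 /= !mulr0 addr0 subr0 !addr0.
by apply/andP; split; apply: ideal_mulr => //; apply: KL.
Qed.

Lemma lattice_proper : proper_submod K -> proper_submod lattice.
Proof.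
move=> /proper_submodP K1; have [q [_ q2]] := coord_surj 0 1.
by exists q; rewrite latticeE q2 (negPf K1) andbF.
Qed.

End Lattice.

(** * Projective classes and exact elements of L *)

Lemma maximal_comaximalX (R : comNzRingType) (P Q : ideal R) n k :
  maximal_ideal P -> maximal_ideal Q -> P <> Q ->
  comaximal (idealX P n) (idealX Q k).
Proof.
move=> maxP maxQ neqPQ; apply/comaximalX/comaximalC/comaximalX/comaximalC.
by apply: maximal_comaximal => // /(maximal_sub_eq maxP maxQ).
Qed.

Lemma PF1_class_eq (O : idomainType) (I : ideal O) (p q : O * O) :
  unimodular p -> unimodular q -> p.1 * q.2 - p.2 * q.1 \in I ->
  PF1_class I q = PF1_class I p.
Proof.
move=> up uq pqI.
have trans p1 p2 p3 : unimodular p2 -> p1.1 * p2.2 - p1.2 * p2.1 \in I ->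
    p2.1 * p3.2 - p2.2 * p3.1 \in I -> p1.1 * p3.2 - p1.2 * p3.1 \in I.
  (* Transitivity needs the middle pair unimodular: the determinant of p1 and p3 is multiplied by 1
     = x p2.1 + y p2.2 and expanded in the other two determinants. *)
  move=> /(_ 1)[x [y xy]] I12 I23; rewrite -[_ - _]mulr1 xy.
  have -> : (p1.1 * p3.2 - p1.2 * p3.1) * (x * p2.1 + y * p2.2) =
      (x * p3.1 + y * p3.2) * (p1.1 * p2.2 - p1.2 * p2.1) +
      (x * p1.1 + y * p1.2) * (p2.1 * p3.2 - p2.2 * p3.1) by ring.
  by apply: ideal_add; apply: ideal_mull.
have qpI : q.1 * p.2 - q.2 * p.1 \in I.
  have -> : q.1 * p.2 - q.2 * p.1 = - (p.1 * q.2 - p.2 * q.1) by ring.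
  exact: ideal_opp.
apply/seteqP; split=> z [uz zI]; split=> //.
  exact: trans uq pqI zI.
exact: trans up qpI zI.
Qed.

Section ExactElements.
Variables (O : idomainType) (dedO : dedekind_domain O).
Variables (L : ideal O) (nzL : ideal_nonzero L) (r : nat) (m : 'I_r -> ideal O).
Hypotheses (maxm : forall i, maximal_ideal (m i)) (injm : injective m).

(** For each i some t i lies in L times the product of the other m j but not in L m i; otherwise
    cancelling L would put that product inside m i. In the sum of the t i, only the term t i is
    outside L m i. *)
Lemma exists_exact : exists2 t, t \in L & forall i, t \notin idealM L (m i).
Proof.
have invL := nonzero_invertible dedO nzL.
have tP0 i : exists t, t \notin idealM L (m i) /\
    t \in idealM L (\big[@idealM O/ideal1 O]_(j | j != i) m j).
  apply: contrapT => not_t.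
  have sub : {subset \big[@idealM O/ideal1 O]_(j | j != i) m j <= m i}.
    apply: (invertible_sub invL) => t tL; apply: contrapT => /negP tmi.
    by apply: not_t; exists t.
  have [|s si sj] :=
      @comaximal_prod _ _ (index_enum 'I_r) (fun j => j != i) m (m i).
    move=> j ji; apply: maximal_comaximal => // /maximal_sub_eq.
    by move=> /(_ (maxm i) (maxm j))/injm eqij; rewrite eqij eqxx in ji.
  have [mi1 _] := maximal_prime (maxm i); case/negP: mi1.
  by rewrite -(subrK s 1) ideal_add // sub.
have [t tP] := choice tP0; exists (\sum_i t i) => [|i].
  by apply: ideal_sum => i _; have [_ /idealM_subl] := tP i.
apply/negP; rewrite (bigD1 i) //= => tLm.
have [/negP tmi _] := tP i; apply: tmi.
rewrite -(addrK (\sum_(j < r | j != i) t j) (t i)); apply: ideal_sub => //.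
apply: ideal_sum => j ji; have [_] := tP j.
by apply: idealMS => //; rewrite (bigD1 i) 1?eq_sym //; apply: idealM_subl.
Qed.

Lemma exact_cancel (e : 'I_r -> nat) t d :
  t \in L -> (forall i, t \notin idealM L (m i)) ->
  t * d \in idealM L (ideal_prod (fun i => idealX (m i) (e i))) ->
  d \in ideal_prod (fun i => idealX (m i) (e i)).
Proof.
move=> tL tm tdLI; set I := ideal_prod _ in tdLI *.
have invL := nonzero_invertible dedO nzL.
have [J tE] := invertible_dvd invL (principal_sub tL).
(* If J were inside some m i, then t would lie in L m i. *)
have coJI : comaximal J I.
  apply: comaximal_prod => i _; apply/comaximalX/maximal_comaximal => // Jm.
  case/negP: (tm i); have := principal_id t; rewrite tE; exact: idealMS.
have JdI : {subset idealM J (principal d) <= I}.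
  apply: (invertible_sub invL); rewrite idealMA -tE principalM.
  exact: principal_sub.
have [j jJ jI] := coJI.
have -> : d = j * d + d * (1 - j) by ring.
by apply: ideal_add; [apply/JdI/mem_idealM/principal_id | apply: ideal_mull].
Qed.

End ExactElements.

(** * Construction of M from the given invariants *)

Unset Implicit Arguments.

Theorem mainTheorem2 (O : idomainType) (dedO : dedekind_domain O)
    (L K I : ideal O) (L_neq0 : ideal_nonzero L) (K_neq0 : ideal_nonzero K)
    (K_sub_L : {subset K <= L}) (K_proper : proper_submod K)
    (K_factor : K =i idealM L I)
    (c : set (O * O)) (cP : PF1 I c) :
  exists M : submodClosed (O^o * O^o)%type,
    [/\ cotorsion M, proper_submod M, invariant_factors M L K &
        projective_invariant M c].
Proof.
have {K_factor} KLI : K = idealM L I by apply: submod_ext.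
have nzI : ideal_nonzero I.
  by case: K_neq0 => z; rewrite KLI => /idealM_subr; exists z.
(* Factoring L and I, not L and K, makes l <= k automatic for k = l + e. *)
have [r [m [l [e [maxm injm le0 LE IE]]]]]  :=
  common_factorization dedO L_neq0 nzI.
have KE : K = ideal_prod (fun i => idealX (m i) (l i + e i)).
  rewrite KLI LE IE /ideal_prod -big_split /=.
  by apply: eq_bigr => i _; rewrite idealXD.
case: cP => -[a b] uab ->; have [x [y /esym xayb]] := uab 1.
have comax (n : 'I_r -> nat) i j : i != j ->
    comaximal (idealX (m i) (n i)) (idealX (m j) (n j)).
  by move/eqP=> neqij; apply: maximal_comaximalX => // /injm.
have elemM :
    elementary_divisors (lattice L K a b x y) m l (fun i => l i + e i)%N.
  split=> //.
  - by move=> i j /submod_ext/injm.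
  - by move=> i; apply: leq_addr.
  - by move=> i; rewrite -lt0n.
  - by apply: lattice_iso => //; apply: comax.
exists (lattice L K a b x y); split.
- exact: lattice_cotorsion.
- exact: lattice_proper.
- exists r, m, l, (fun i => l i + e i)%N.
  by split=> // z; [rewrite {1}LE | rewrite {1}KE].
exists r, m, l, (fun i => l i + e i)%N; split=> //=.
have -> : ideal_prod (fun i => idealX (m i) (l i + e i - l i)) = I.
  by rewrite IE; apply: eq_bigr => i _; rewrite addKn.
rewrite -LE; split=> [|p [up [t [tL tm]]]].
  (* The pair (a, b) itself is admissible: t (a, b) has coordinates t and 0. *)
  have [t tL tm] := exists_exact dedO L_neq0 maxm injm.
  exists (a, b); split=> //; exists t; split=> //=.
  rewrite latticeE /coord1 /coord2 /=.
  have -> : x * (t * a) + y * (t * b) = t * (x * a + y * b) by ring.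
  have -> : a * (t * b) - b * (t * a) = 0 by ring.
  by rewrite xayb mulr1 tL ideal_0.
(* For any admissible p only the second coordinate matters: it is t times the determinant of (a, b)
   and p. *)
rewrite latticeE /coord2 /= => /andP[_].
have -> : a * (t * p.2) - b * (t * p.1) = t * (a * p.2 - b * p.1) by ring.
rewrite KLI => tdLI; apply: PF1_class_eq => //=; rewrite IE.
apply: (exact_cancel dedO L_neq0 maxm) tL tm _.
by rewrite -IE.
Qed.
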